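(* Let $\mathcal{R} = ((M, G, \triangleright), (m_0, \{g_{m_0,m}\}_{m \in M}))$ be a finitely right generated cell space such that the stabiliser $G_0$ of $m_0$ under $\triangleright$ is finite. Let the group $G$ be finitely generated and let it have sub-exponential growth. Then the cell space $\mathcal{R}$ has sub-exponential growth and is right amenable.
   Context: A \emph{left homogeneous space} is a triple $(M, G, \triangleright)$ where $M$ is a non-empty set, $G$ is a group, and $\triangleright : G \times M \to M$ is a transitive left group action. A \emph{coordinate system} for it is a tuple $(m_0, \{g_{m_0,m}\}_{m\in M})$ with $m_0 \in M$, $g_{m_0,m} \in G$ and $g_{m_0,m} \triangleright m_0 = m$ for each $m \in M$. A left homogeneous space together with a coordinate system is a \emph{cell space}. $G_0$ is the stabiliser of $m_0$, and $G/G_0$ is the set of left cosets $gG_0$, on which $G$ (hence $G_0$) acts by left multiplication, $g \cdot g'G_0 = gg'G_0$. The cell space induces the map $\trianglelefteq : M \times G/G_0 \to M$, $m \trianglelefteq gG_0 = g_{m_0,m}\, g\, g_{m_0,m}^{-1} \triangleright m = g_{m_0,m}\, g \triangleright m_0$. \textbf{Right generating sets.} Let $S \subseteq G/G_0$ with $G_0 \cdot S \subseteq S$. Put $S^{-1} = \{g^{-1}G_0 : s \in S, g \in s\}$. $S$ is a \emph{right generating set} of $\mathcal{R}$ if for each $m \in M$ there are $k \in \mathbb{N}_0$ and $s_1, \dots, s_k \in S \cup S^{-1}$ with $(((m_0 \trianglelefteq s_1) \trianglelefteq s_2) \trianglelefteq \cdots) \trianglelefteq s_k = m$. It is \emph{symmetric}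 if $S^{-1} \subseteq S$. $\mathcal{R}$ is \emph{finitely right generated} if it has a finite right generating set; if in addition $G_0$ is finite, then it has a finite symmetric one. \textbf{Growth.} Let $S$ be a finite symmetric right generating set. The $S$-metric is $d_S(m,m') = \min\{k \in \mathbb{N}_0 : \exists s_1,\dots,s_k \in S,\ (((m \trianglelefteq s_1) \trianglelefteq s_2) \trianglelefteq \cdots) \trianglelefteq s_k = m'\}$, $\mathbb{B}_S(k) = \{m \in M : d_S(m_0,m) \le k\}$, and $\gamma_S : \mathbb{N}_0 \to \mathbb{N}_0$, $\gamma_S(k) = |\mathbb{B}_S(k)|$. For non-decreasing maps $\gamma, \gamma' : \mathbb{N}_0 \to \mathbb{R}_{\ge 0}$ (growth functions), $\gamma$ \emph{dominates} $\gamma'$ if there is a positive integer $\alpha$ with $\alpha \gamma(\alpha k) \ge \gamma'(k)$ for all positive integers $k$; $\gamma$ and $\gamma'$ are \emph{equivalent} if each dominates the other. The \emph{growth type} $\gamma(\mathcal{R})$ is the equivalence class of $\gamma_S$ (it does not depend on $S$). $\mathcal{R}$ has \emph{exponential growth} if $\gamma(\mathcal{R})$ is the equivalence class of $\exp$ (that is, $k \mapsto e^k$), and \emph{sub-exponential growth} otherwise. For the finitely generated group $G$, growth is the usual word growth: for a finite symmetric generating set $T$ of $G$, $\gamma_T^G(k)$ is the number of elements of $G$ that are products of at most $k$ elements of $T$; the growth type of $G$ is the equivalence class of $\gamma_T^G$ (independent of $T$), and $G$ has sub-exponential growth if this class is not that of $\exp$. \textbf{Right amenability.} $\mathcal{R}$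 is \emph{right amenable} if there is a finitely additive probability measure $\mu$ on the power set of $M$ such that for each $\mathfrak{g} \in G/G_0$ and each $A \subseteq M$ such that the map $A \to M$, $m \mapsto m \trianglelefteq \mathfrak{g}$, is injective, we have $\mu(A \trianglelefteq \mathfrak{g}) = \mu(A)$, where $A \trianglelefteq \mathfrak{g} = \{a \trianglelefteq \mathfrak{g} : a \in A\}$. *)

(* Defs.v *)
From HB Require Import structures.
From mathcomp Require Import all_boot all_order all_algebra finmap.
From mathcomp Require Import all_classical all_reals all_analysis.

Set Implicit Arguments.
Unset Strict Implicit.
Unset Printing Implicit Defensive.

Import Order.TTheory GRing.Theory Num.Theory.

Local Open Scope classical_set_scope.
Local Open Scope ring_scope.

(* The carrier M is a choiceType as is every carrier in MathComp; under the
   classical axioms of MathComp-Analysis any type is one. *)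
Record homogeneous_space (G : groupType) (M : choiceType) := HomogeneousSpace {
  act :> G -> M -> M;
  space_nonempty : inhabited M;
  act1 : forall m, act 1%g m = m;
  actM : forall g h m, act (g * h)%g m = act g (act h m);
  act_transitive : forall m m', exists g, act g m = m' }.

Record cell_space (G : groupType) (M : choiceType) := CellSpace {
  space :> homogeneous_space G M;
  origin : M;
  coord : M -> G;
  coordP : forall m, space (coord m) origin = m }.

Section CellSpace.
Variables (G : groupType) (M : choiceType) (X : cell_space G M).
Implicit Types (g h : G) (m : M) (C : set G) (S : set (set G)) (k : nat).

Definition stabiliser : set G := [set g | X g (origin X) = origin X].

(* The left translate gA. Left cosets of the stabiliser are represented as
   subsets of G; translation is the left action of G on them. *)
Definition ltrans g (A : set G) : set G := [set (g * a)%g | a in A].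

Definition lcosets : set (set G) := [set ltrans g stabiliser | g in [set: G]].

(* m <| C, computed from a chosen element of the coset C; the choice is
   irrelevant by semiactE below. *)
Definition semiact m C : M :=
  X (coord X m * xget 1%g C * (coord X m)^-1)%g m.

Definition coset_inv S : set (set G) :=
  [set ltrans g^-1%g stabiliser | g in [set g | exists2 C, S C & C g]].

(* m' = (((m <| C1) <| C2) <| ...) <| Ck for some C1, ..., Ck in S. *)
Definition walk S k m m' :=
  exists s : seq (set G),
    [/\ size s = k, [set` s] `<=` S & foldl semiact m s = m'].

Definition right_generating S :=
  [/\ S `<=` lcosets,
      forall g C, stabiliser g -> S C -> S (ltrans g C)
    & forall m, exists k, walk (S `|` coset_inv S) k (origin X) m].

Definition symmetric_cosets S := coset_inv S `<=` S.

Definition finitely_right_generated :=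
  exists2 S, finite_set S & right_generating S.

Definition fin_sym_right_generating S :=
  [/\ finite_set S, right_generating S & symmetric_cosets S].

(* The default value 0 is never taken between origin X and a point of M when
   S is a symmetric right generating set, see walk_origin. *)
Definition cell_dist S m m' : nat :=
  match pselect (exists k, `[< walk S k m m' >]) with
  | left ex => ex_minn ex
  | right _ => 0%N
  end.

Definition cell_ball S k : set M :=
  [set m | (cell_dist S (origin X) m <= k)%N].

(* fset_set returns the empty set on infinite sets; the balls are finite when S
   is. *)
Definition cell_gamma S k : nat := #|` fset_set (cell_ball S k)|.

Lemma semiactE m g :
  semiact m (ltrans g stabiliser) = X (coord X m * g)%g (origin X).
Proof.
have : ltrans g stabiliser (xget 1%g (ltrans g stabiliser)).
  by apply: (@xgetI _ _ _ (g * 1)%g); exists 1%g => //; exact: act1.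
rewrite /semiact => -[h hstab <-].
rewrite -[X in space _ _ X](coordP X m) -actM -!mulgA mulVg mulg1 mulgA.
by rewrite [LHS]actM hstab.
Qed.

Lemma walk_origin S m :
  right_generating S -> symmetric_cosets S -> exists k, walk S k (origin X) m.
Proof.
move=> [_ _ gen] sym; have [k [s [szs sS <-]]] := gen m.
by exists k, s; split=> // C /sS[//|/sym].
Qed.

Lemma fin_sym_right_generating_ex :
  finitely_right_generated -> finite_set stabiliser ->
  exists S, fin_sym_right_generating S.
Proof.
move=> [S Sfin [Scos Sact Sgen]] fin0.
have stab1 : stabiliser 1%g by exact: act1.
have stabV g : stabiliser g -> stabiliser g^-1%g.
  by move=> sg; rewrite /stabiliser /= -{1}sg -actM mulVg act1.
have stabM g h : stabiliser g -> stabiliser h -> stabiliser (g * h)%g.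
  by move=> sg sh; rewrite /stabiliser /= actM sh.
have ltM g h A : ltrans g (ltrans h A) = ltrans (g * h)%g A.
  apply/seteqP; split=> x /=.
    by move=> [_ [a Aa <-] <-]; exists a; rewrite // mulgA.
  by move=> [a Aa <-]; exists (h * a)%g; [exists a|rewrite mulgA].
have lt_stab g : stabiliser g -> ltrans g stabiliser = stabiliser.
  move=> sg; apply/seteqP; split=> x /=.
    by move=> [a sa <-]; exact: stabM.
  move=> sx; exists (g^-1 * x)%g; last by rewrite mulVKg.
  by apply: stabM => //; exact: stabV.
have mem_coset C g : S C -> C g -> C = ltrans g stabiliser.
  by move=> /Scos[h _ <-] [a sa <-]; rewrite -ltM (lt_stab a).
exists (S `|` coset_inv S); split.
- rewrite finite_setU; split=> //; apply: finite_image.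
  suff -> : [set g | exists2 C, S C & C g] = \bigcup_(C in S) C.
    apply: bigcup_finite => // C /Scos[g _ <-]; exact: finite_image.
  by apply/seteqP; split=> x [C]; exists C.
- split.
  + by move=> C [/Scos//|[g _ <-]]; exists g^-1%g.
  + move=> g C sg [SC|[h [D SD Dh] <-]]; first by left; exact: Sact.
    right; exists (h * g^-1)%g; last by rewrite invgM invgK ltM.
    exists D => //=; rewrite (mem_coset _ _ SD Dh).
    by exists g^-1%g => //; exact: stabV.
  + move=> m; have [k [s [szs sS <-]]] := Sgen m.
    by exists k, s; split=> // C /sS; left.
- move=> _ [g [C [SC|[h [D SD Dh] <-]] Cg] <-].
    by right; exists g => //; exists C.
  move: Cg => [a sa <-]; left; rewrite invgM invgK -ltM -(mem_coset _ _ SD Dh).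
  by apply: Sact => //; exact: stabV.
Qed.

End CellSpace.

Section GroupGrowth.
Variable G : groupType.
Implicit Types (T : set G) (k : nat).

Definition set_inv T : set G := [set t^-1%g | t in T].

Definition generating T :=
  forall g, exists2 s : seq G,
    [set` s] `<=` T `|` set_inv T & (\prod_(t <- s) t)%g = g.

Definition fin_generated := exists2 T, finite_set T & generating T.

Definition fin_sym_generating T :=
  [/\ finite_set T, generating T & set_inv T `<=` T].

Definition word_ball T k : set G :=
  [set g | exists s : seq G,
     [/\ (size s <= k)%N, [set` s] `<=` T & (\prod_(t <- s) t)%g = g]].

Definition word_gamma T k : nat := #|` fset_set (word_ball T k)|.

End GroupGrowth.

Section GrowthTypes.
Variable R : realType.
Implicit Types f h : nat -> R.

Definition growth_function f :=
  {homo f : k l / (k <= l)%N >-> k <= l} /\ (forall k, 0 <= f k).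

Definition dominates f h :=
  exists2 a : nat, (0 < a)%N &
    forall k, (0 < k)%N -> h k <= a%:R * f (a * k)%N.

Definition growth_equiv f h := dominates f h /\ dominates h f.

Definition growth_class f : set (nat -> R) :=
  [set h | growth_function h /\ growth_equiv f h].

Definition exp_class : set (nat -> R) := growth_class (fun k => expR k%:R).

(* The classes of the functions cell_gamma X S (resp. word_gamma T) coincide
   for all finite symmetric right generating sets S (resp. generating sets T),
   so that each union below is the common class. Such an S exists as soon as X is
   finitely right generated with a finite stabiliser, by
   fin_sym_right_generating_ex. *)
Definition cell_growth_type (G : groupType) (M : choiceType)
    (X : cell_space G M) : set (nat -> R) :=
  \bigcup_(S in [set S | fin_sym_right_generating X S])
    growth_class (fun k => (cell_gamma X S k)%:R).

Definition group_growth_type (G : groupType) : set (nat -> R) :=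
  \bigcup_(T in [set T : set G | fin_sym_generating T])
    growth_class (fun k => (word_gamma T k)%:R).

Definition cell_exponential_growth (G : groupType) (M : choiceType)
    (X : cell_space G M) := cell_growth_type X = exp_class.

Definition cell_subexponential_growth (G : groupType) (M : choiceType)
    (X : cell_space G M) := ~ cell_exponential_growth X.

Definition group_exponential_growth (G : groupType) :=
  group_growth_type G = exp_class.

Definition group_subexponential_growth (G : groupType) :=
  ~ group_exponential_growth G.

End GrowthTypes.

Arguments cell_exponential_growth R {G M} X.
Arguments cell_subexponential_growth R {G M} X.

Section Amenability.
Variable R : realType.

Definition fin_additive_probability (M : choiceType) (mu : set M -> R) :=
  [/\ forall A, 0 <= mu A, mu setT = 1
    & forall A B, A `&` B = set0 -> mu (A `|` B) = mu A + mu B].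

Definition right_amenable (G : groupType) (M : choiceType)
    (X : cell_space G M) :=
  exists2 mu : set M -> R, fin_additive_probability mu &
    forall (C : set G) (A : set M), lcosets X C ->
      {in A &, injective (fun m => semiact X m C)} ->
      mu [set semiact X a C | a in A] = mu A.

End Amenability.

Arguments right_amenable R {G M} X.

(* Main.v *)
Require Import Defs.
From mathcomp Require Import all_boot all_order all_algebra finmap.
From mathcomp Require Import all_classical all_reals all_analysis.
From mathcomp Require Import lra.

(* Write B(k) for the word ball of G for a finite symmetric generating set, and
   o for the origin. Since S is closed under the stabiliser, walking along
   C_1, ..., C_k in S from o leads to g_1 ... g_k o with g_i in the finite set
   of elements of cosets in S, so cell balls are no larger than word balls, and
   exponential growth of X would force exponential growth of G.

   For amenability, the sets F(n) = B(n) o have at most |B(n)| elements. If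
   |F(n + K)| exceeded (1 + e)|F(n)| for some K, e > 0 and all n, they would
   grow exponentially; hence along some sequence n_j every F(n_j + K) is
   asymptotically as large as F(n_j). The point m lies in F(n + K) as soon as
   m <| C lies in F(n), and conversely, for some K depending on C only, so an
   ultrafilter limit of |A meet F(n_j)| / |F(n_j)| is the required measure. *)

Set Implicit Arguments.
Unset Strict Implicit.
Unset Printing Implicit Defensive.

Import Order.TTheory GRing.Theory Num.Theory.
Import numFieldNormedType.Exports.

Local Open Scope classical_set_scope.
Local Open Scope ring_scope.

Local Notation card A := (#|` fset_set A|).

(** * Cardinalities of finite sets *)

Section FiniteSets.
Variables T U : choiceType.
Implicit Types A B : set T.

Lemma leq_card_set A B : finite_set B -> A `<=` B -> (card A <= card B)%N.
Proof.
move=> Bfin AB; have Afin := sub_finite_set AB Bfin.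
by apply: fsubset_leq_card; rewrite -fset_set_sub.
Qed.

Lemma leq_card_setU A B : finite_set A -> finite_set B ->
  (card (A `|` B) <= card A + card B)%N.
Proof. by move=> Af Bf; rewrite fset_setU// cardfsU leq_subr. Qed.

Lemma card_setU_disjoint A B : finite_set A -> finite_set B ->
  A `&` B = set0 -> card (A `|` B) = (card A + card B)%N.
Proof.
move=> Af Bf AB; rewrite fset_setU// cardfsU -fset_setI// AB fset_set0.
by rewrite cardfs0 subn0.
Qed.

Lemma card_set_gt0 A : finite_set A -> A !=set0 -> (0 < card A)%N.
Proof.
move=> Af [x Ax]; rewrite cardfs_gt0; apply/fset0Pn; exists x.
by rewrite in_fset_set// inE.
Qed.

Lemma leq_card_image (f : T -> U) A : finite_set A ->
  (card (f @` A) <= card A)%N.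
Proof. by move=> Af; rewrite fset_set_image// leq_imfset_card. Qed.

Lemma card_image_inj (f : T -> U) A : finite_set A ->
  {in A &, injective f} -> card (f @` A) = card A.
Proof.
move=> Af finj; rewrite fset_set_image//; apply: card_in_imfset => x y.
by rewrite !in_fset_set//; exact: finj.
Qed.

End FiniteSets.

(** * Ultrafilter limits and invariant means *)

Lemma ultra_fmap (T U : Type) (f : T -> U) (F : set_system T) :
  UltraFilter F -> UltraFilter (f @ F).
Proof.
move=> FU; split=> [|G Gproper fFG]; first exact: fmap_proper_filter.
apply/seteqP; split=> // B GB.
(* If the preimage of [B] is not in [F], its complement is, and then [G] contains two disjoint
   sets. *)
have [//|FnB] := in_ultra_setVsetC (f @^-1` B) FU.
have GnB : G (~` B) by exact: fFG.
by have /filter_ex[x []] : G (B `&` ~` B) by exact: filterI.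
Qed.

Section Mean.
Variables (R : realType) (M : choiceType) (F : nat -> set M).
Hypotheses (Ffin : forall n, finite_set (F n)) (F0 : F 0%N !=set0).
Hypothesis Fle : forall m n, (m <= n)%N -> F m `<=` F n.

Let Icfin A n : finite_set (A `&` F n).
Proof. exact: sub_finite_set (@subIsetr _ _ _) (Ffin n). Qed.

(** A point of [A] in F(n) whose image leaves F(n) is sent into the shell F(n + K) minus F(n); a
    point of [A] outside F(n) whose image falls in F(n) lies in that shell itself. So neither count
    exceeds the other by more than the shell; the additive form avoids truncated subtraction. *)
Lemma card_displaced f (A : set M) K n :
  (forall n m, F n m -> F (n + K) (f m)) ->
  (forall n m, F n (f m) -> F (n + K) m) ->
  {in A &, injective f} ->
  (card (A `&` F n) + card (F n) <= card (f @` A `&` F n) + card (F (n + K)) /\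
   card (f @` A `&` F n) + card (F n) <= card (A `&` F n) + card (F (n + K)))%N.
Proof.
move=> fF Ff finj.
have FK : F n `<=` F (n + K) by apply: Fle; exact: leq_addr.
have Dfin : finite_set (F (n + K) `\` F n) by exact: finite_setD.
have FKE : card (F (n + K)) = (card (F n) + card (F (n + K) `\` F n))%N.
  by rewrite -card_setU_disjoint ?setDUK ?setDIK.
rewrite FKE !(addnC (card (F n))) !addnA !leq_add2r; split.
  apply: (@leq_trans (card (f @` (A `&` F n)))).
    rewrite card_image_inj// => x y /set_mem[Ax _] /set_mem[Ay _].
    by apply: finj; exact/mem_set.
  apply: leq_trans (leq_card_setU (Icfin _ _) Dfin); apply: leq_card_set.
    by rewrite finite_setU.
  move=> _ [a [Aa Fa] <-]; have [Ffa|Ffa] := pselect (F n (f a)).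
    by left; split=> //; exists a.
  by right; split=> //; exact: fF.
apply: leq_trans (leq_card_setU (Icfin _ _) Dfin).
apply: (@leq_trans (card (f @` (A `&` F n `|` F (n + K) `\` F n)))).
  apply: leq_card_set; first by apply: finite_image; rewrite finite_setU.
  move=> _ [[a Aa <-] /[dup] Fa /Ff FKa]; exists a => //.
  by have [Fna|Fna] := pselect (F n a); [left|right].
by apply: leq_card_image; rewrite finite_setU.
Qed.

Lemma folner_mean :
  (forall j, exists n,
    card (F (n + j.+1)) * j.+1 <= card (F n) * j.+2)%N ->
  exists2 mu : set M -> R, fin_additive_probability mu &
    forall f (A : set M) K,
      (forall n m, F n m -> F (n + K) (f m)) ->
      (forall n m, F n (f m) -> F (n + K) m) ->
      {in A &, injective f} -> mu (f @` A) = mu A.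
Proof.
move=> /choice[n_ n_P].
(* [U] contains every eventual set, so limits at infinity persist along it. *)
have [U [Uultra ooU]] := ultraFilterLemma (eventually_filter).
have UF : ProperFilter U by exact: ultra_proper.
pose c j : R := (card (F (n_ j)))%:R.
pose x A j : R := (card (A `&` F (n_ j)))%:R / c j.
have c_gt0 j : 0 < c j.
  rewrite ltr0n card_set_gt0//.
  by case: F0 => m; exists m; exact: (Fle (leq0n _)).
have x01 A j : 0 <= x A j <= 1.
  rewrite divr_ge0 ?ler0n// ler_pdivrMr// mul1r ler_nat.
  by apply: leq_card_set => //; exact: subIsetr.
have xcvg A : cvg (x A @ U).
  (* The frequencies lie in the compact interval [0, 1], so they converge along [U]. *)
  have := @segment_compact R 0 1; rewrite compact_ultra.
  move=> /(_ (x A @ U) (ultra_fmap _ _))[|l [_ xl]]; last first.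
    by apply/cvg_ex; exists l.
  suff : U (x A @^-1` `[0, 1]) by [].
  by apply: filterE => j; rewrite /= in_itv /= x01.
exists (fun A => lim (x A @ U)).
  split=> [A||A B AB].
  - by apply: limr_ge => //; apply: nearW => j; case/andP: (x01 A j).
  - rewrite (_ : x setT = cst 1) ?lim_cst//; apply/funext => j.
    by rewrite /x setTI divff// gt_eqF ?c_gt0.
  - rewrite -limD//; congr (lim (_ @ U)); apply/funext => j /=.
    rewrite /x setIUl card_setU_disjoint// ?natrD ?mulrDl//.
    by rewrite setIACA AB set0I.
move=> f A K fF Ff finj; apply/eqP; rewrite -subr_eq0 -limB//; apply/eqP.
apply: cvg_lim => //.
have h_cvg : @harmonic R @ U --> (0 : R).
  by apply: cvg_trans (cvg_harmonic); move=> P /ooU.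
have hN_cvg : (- @harmonic R) @ U --> (0 : R).
  by rewrite -oppr0; exact: cvgN.
apply: squeeze_cvgr hN_cvg h_cvg.
(* For j >= K, F(n_j + K) lies in F(n_j + j + 1), so the shell has at most |F(n_j)| / (j + 1)
   elements, whence the harmonic bound. *)
apply: ooU; exists K => // j /= Kj.
have le_card : (card (F (n_ j + K)))%:R * j.+1%:R <= c j * j.+2%:R.
  rewrite /c -!natrM ler_nat (leq_trans _ (n_P j))// leq_mul2r.
  by rewrite leq_card_set ?orbT//; apply: Fle; rewrite leq_add2l ltnW.
have [] := card_displaced (n_ j) fF Ff finj.
rewrite -2!(ler_nat R) !natrD -/(c j) => le1 le2.
have j0 : 0 < (j.+1)%:R :> R by rewrite ltr0n.
rewrite !fctE /x /= -mulrBl lter_pdivlMr// lter_pdivrMr// mulNr.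
have le3 : (card (F (n_ j + K)))%:R - c j <= j.+1%:R^-1 * c j.
  rewrite ler_pdivlMl//; move: le_card; rewrite -[j.+2%:R]natr1; lra.
move: le1 le2 le3; move: (c j) (j.+1%:R^-1 * _) => c0 h; clear.
move: (_%:R) (_%:R) (_%:R) => a b d le1 le2 le3.
by apply/andP; split; lra.
Qed.

End Mean.

(** * Word balls in a group *)

Section WordBalls.
Variable G : groupType.
Implicit Types (T A : set G) (g h : G) (k n : nat).

Lemma word_ball_le T m n : (m <= n)%N -> word_ball T m `<=` word_ball T n.
Proof.
by move=> mn g [s [szs sT <-]]; exists s; split=> //; exact: leq_trans mn.
Qed.

Lemma word_ball_id T k : word_ball T k 1%g.
Proof. by exists [::]; split=> //; rewrite big_nil. Qed.

Lemma word_ballM T m n g h :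
  word_ball T m g -> word_ball T n h -> word_ball T (m + n) (g * h)%g.
Proof.
move=> [s [szs sT <-]] [t [szt tT <-]]; exists (s ++ t); split.
- by rewrite size_cat leq_add.
- by move=> x /=; rewrite mem_cat => /orP[/sT|/tT].
- by rewrite big_cat.
Qed.

Lemma word_ball1 T g : T g -> word_ball T 1 g.
Proof.
move=> Tg; exists [:: g]; split=> //; last by rewrite big_seq1.
by move=> x /=; rewrite inE => /eqP ->.
Qed.

(** Split off the first letter; 1 stands in for it when the word is empty. This recursion gives both
    the finiteness of balls and their exponential bound. *)
Lemma word_ballS T k : word_ball T k.+1 `<=`
  [set x.1 * x.2 | x in (1 |` T) `*` word_ball T k]%g.
Proof.
move=> _ [[|t s] [szs sT <-]].
  exists (1, 1)%g; rewrite /= ?mulg1 ?big_nil//; split; first by left.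
  exact: word_ball_id.
exists (t, \prod_(t <- s) t)%g; rewrite /= ?big_cons//; split=> /=.
  by right; apply: sT; rewrite /= mem_head.
by exists s; split=> // x xs; apply: sT; rewrite /= in_cons xs orbT.
Qed.

Lemma word_ball_sub T A n k :
  A `<=` word_ball T n -> word_ball A k `<=` word_ball T (n * k).
Proof.
move=> AT; elim: k => [|k IHk] g.
  case=> [[|t s] []//] _ _ <-; rewrite big_nil; exact: word_ball_id.
move=> /word_ballS[[a h] /= [[->|/AT aT] /IHk hT] <-]; rewrite mulnS.
  by rewrite mul1g; apply: word_ball_le hT; exact: leq_addl.
exact: word_ballM.
Qed.

Lemma finite_word_ball T k : finite_set T -> finite_set (word_ball T k).
Proof.
move=> Tfin; elim: k => [|k IHk].
  apply: (@sub_finite_set _ _ [set 1%g]) => // _ [[|t s] []//] _ _ <-.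
  by rewrite big_nil.
apply: sub_finite_set (@word_ballS T k) _; apply: finite_image.
by apply: finite_setX => //; rewrite finite_setU.
Qed.

Lemma word_gamma_exp T k : finite_set T ->
  (word_gamma T k <= (card (1%g |` T)) ^ k)%N.
Proof.
move=> Tfin; have T1fin : finite_set (1%g |` T) by rewrite finite_setU.
have wfin := finite_word_ball _ Tfin.
elim: k => [|k IHk].
  rewrite expn0 -(cardfs1 (1%g : G)) -fset_set1; apply: leq_card_set => //.
  by move=> _ [[|t s] []//] _ _ <-; rewrite big_nil.
rewrite expnS; apply: leq_trans (leq_mul (leqnn _) IHk).
rewrite -(size_allpairs (fun a h : G => (a * h)%g)).
apply: uniq_leq_size (fset_uniq _) _ => g.
rewrite in_fset_set// => /set_mem/word_ballS[[a h] /= [aT hT] <-].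
by apply: allpairs_f; rewrite in_fset_set//; exact/mem_set.
Qed.

Lemma sym_generating_word_ball T g : generating T -> set_inv T `<=` T ->
  exists k, word_ball T k g.
Proof.
move=> genT symT; have [s sT <-] := genT g.
by exists (size s), s; split=> // x /sT[|/symT].
Qed.

Lemma finite_sub_word_ball T A : generating T -> set_inv T `<=` T ->
  finite_set A -> exists k, A `<=` word_ball T k.
Proof.
move=> genT symT /finite_seqP[s ->]; elim: s => [|g s [k sk]].
  by exists 0%N.
have [n gn] := sym_generating_word_ball g genT symT.
exists (n + k)%N => x /=; rewrite inE => /orP[/eqP->|xs].
  exact: (word_ball_le (leq_addr _ _)).
by apply: (word_ball_le (leq_addl _ _)); exact: sk.
Qed.

(** Used to turn the elements of [A] into letters without losing generation, and to symmetrise. *)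
Lemma fin_sym_generatingU T A : generating T -> finite_set T -> finite_set A ->
  fin_sym_generating ((T `|` A) `|` set_inv (T `|` A)).
Proof.
move=> genT Tfin Afin; split.
- by rewrite !finite_setU; split=> //; apply: finite_image; rewrite finite_setU.
- move=> g; have [s sT <-] := genT g; exists s => // x /sT[Tx|[t Tt <-]].
    by left; left; left.
  by left; right; exists t => //; left.
- by move=> _ [g [TAg|[h TAh <-]] <-]; [right; exists g|left; rewrite invgK].
Qed.

End WordBalls.

(** * Comparison of growth functions *)

Section GrowthTypes.
Variable R : realType.
Implicit Types f g h : nat -> R.

Lemma dominates_trans f g h : dominates f g -> dominates g h -> dominates f h.
Proof.
move=> [a a0 fg] [b b0 gh]; exists (b * a)%N; first by rewrite muln_gt0 b0.
move=> k k0; apply: le_trans (gh _ k0) _; rewrite natrM -mulrA ler_wpM2l//.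
by rewrite -mulnA mulnCA; apply: fg; rewrite muln_gt0 b0.
Qed.

Lemma growth_equiv_class f g : growth_equiv f g ->
  growth_class f = growth_class g.
Proof.
move=> [fg gf]; apply/seteqP; split=> h [hgr [ah ha]]; split=> //; split.
- exact: dominates_trans ah.
- exact: dominates_trans fg.
- exact: dominates_trans ah.
- exact: dominates_trans gf.
Qed.

Lemma le_dominates f g h :
  (forall k, f k <= g k) -> dominates f h -> dominates g h.
Proof.
move=> fg [a a0 fh]; exists a => // k k0; apply: le_trans (fh _ k0) _.
exact: ler_wpM2l.
Qed.

(** Otherwise [u] grows by more than the factor (j + 2)/(j + 1) over every j + 1 steps. This factor
    is at least exp(1/(j + 2)), so [u] dominates the exponential with constant (j + 1)(j + 2). *)
Lemma subexponential_ratio (u : nat -> nat) : (0 < u 0)%N ->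
  ~ dominates (fun k => (u k)%:R) (fun k => expR k%:R : R) ->
  forall j, exists n, (u (n + j.+1) * j.+1 <= u n * j.+2)%N.
Proof.
move=> u0 usub j; apply: contrapT => /forallNP ubig; apply: usub.
have j1 : 0 < j.+1%:R :> R by rewrite ltr0n.
have j2 : 0 < j.+2%:R :> R by rewrite ltr0n.
(* Taking inverses, this is exp(-1/(j + 2)) >= 1 - 1/(j + 2) = (j + 1)/(j + 2). *)
have expj : expR j.+2%:R^-1 <= j.+2%:R / j.+1%:R :> R.
  rewrite -[leRHS]invf_div -[leLHS]invrK -expRN.
  rewrite lef_pV2 ?posrE ?expR_gt0 ?divr_gt0//.
  apply: le_trans (expR_ge1Dx _).
  rewrite ler_pdivrMr// mulrDl mulNr mulVf ?gt_eqF//.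
  by rewrite mul1r -(natr1 j.+1) addrK.
have expu i : expR j.+2%:R^-1 ^+ i <= (u (j.+1 * i)%N)%:R :> R.
  elim: i => [|i IHi]; first by rewrite muln0 expr0 ler1n.
  rewrite exprSr mulnSr.
  apply: (@le_trans _ _ ((u (j.+1 * i)%N)%:R * (j.+2%:R / j.+1%:R))).
    by rewrite ler_pM ?exprn_ge0 ?expR_ge0.
  rewrite mulrA ler_pdivrMr// -!natrM ler_nat ltnW// ltnNge.
  exact/negP/ubig.
exists (j.+1 * j.+2)%N => // k _.
apply: (@le_trans _ _ (u (j.+1 * j.+2 * k)%N)%:R); last first.
  by rewrite ler_peMl// ler1n.
rewrite -mulnA; apply: le_trans (expu _).
by rewrite -expRM_natr natrM mulKf ?gt_eqF.
Qed.

Variable G : groupType.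
Implicit Types T : set G.

Let wg T k : R := (word_gamma T k)%:R.
Let exp k : R := expR k%:R.

Lemma word_gamma_dominates T T' : fin_sym_generating T ->
  fin_sym_generating T' -> dominates (wg T) (wg T').
Proof.
move=> [Tfin genT symT] [T'fin _ _].
have [n T'T] := finite_sub_word_ball genT symT T'fin.
(* The constant must be positive, and [n] may be 0. *)
exists n.+1 => // k _; apply: (@le_trans _ _ (wg T (n.+1 * k))).
  rewrite ler_nat; apply: leq_card_set; first exact: finite_word_ball.
  apply: (@subset_trans _ (word_ball T (n * k))); first exact: word_ball_sub.
  by apply: word_ball_le; rewrite leq_mul2r leqnSn orbT.
by rewrite ler_peMl// ler1n.
Qed.

Lemma exp_dominates_word_gamma T : finite_set T -> dominates exp (wg T).
Proof.
move=> Tfin; exists (card (1%g |` T)).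
  by apply: card_set_gt0; [rewrite finite_setU|exists 1%g; left].
move=> k _; set b := card _.
have b1 : (1 <= b%:R :> R).
  rewrite ler1n card_set_gt0//; first by rewrite finite_setU.
  by exists 1%g; left.
apply: (@le_trans _ _ (exp (b * k))); last by rewrite ler_peMl// expR_ge0.
apply: (@le_trans _ _ (b%:R ^+ k)).
  by rewrite -natrX ler_nat; exact: word_gamma_exp.
(* From b <= 1 + b <= exp(b) follows b^k <= exp(bk). *)
rewrite /exp mulnC natrM expRM_natl lerXn2r ?nnegrE ?expR_ge0//.
by apply: le_trans (expR_ge1Dx _); rewrite lerDr.
Qed.

(** If one [T] dominated the exponential, every other generating set would too; as the exponential
    dominates all word growth functions, every class in the union defining the growth type would be
    [exp_class]. *)
Lemma subexponential_word_gamma T : group_subexponential_growth R G ->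
  fin_sym_generating T -> ~ dominates (wg T) exp.
Proof.
move=> sub fsgT Texp; apply: sub.
have wgE T' : fin_sym_generating T' -> growth_class (wg T') = @exp_class R.
  move=> fsgT'; apply: growth_equiv_class; split.
    exact: dominates_trans (word_gamma_dominates fsgT' fsgT) Texp.
  by apply: exp_dominates_word_gamma; case: fsgT'.
apply/seteqP; split=> [f [T' fsgT']|f expf].
  by rewrite -/(wg T') wgE.
by exists T => //; rewrite -/(wg T) wgE.
Qed.

End GrowthTypes.

(** * From the cell space to words in the group *)

Section CellSpaces.
Variables (G : groupType) (M : choiceType) (X : cell_space G M).
Implicit Types (T A : set G) (C : set G) (S : set (set G)) (g h : G) (m : M).
Local Notation o := (origin X).
Local Notation G0 := (stabiliser X).

Lemma stabiliser_id : G0 1%g. Proof. exact: act1. Qed.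

Lemma act_eq_stabiliser g h : X g o = X h o -> G0 (g^-1 * h)%g.
Proof. by rewrite /stabiliser /= actM => <-; rewrite -actM mulVg act1. Qed.

(** Both [h] and the coordinate of h o send o to the same point, so they differ by a right factor
    [s] in the stabiliser. This allows any group element to replace the coordinate. *)
Lemma semiact_act g h :
  exists2 s, G0 s & semiact X (X h o) (ltrans g G0) = X (h * (s * g))%g o.
Proof.
exists (h^-1 * Defs.coord X (X h o))%g; last by rewrite semiactE mulgA mulVKg.
by apply: act_eq_stabiliser; rewrite coordP.
Qed.

Lemma walk_word_ball S k m : right_generating X S -> walk X S k o m ->
  exists2 g, word_ball (\bigcup_(C in S) C) k g & X g o = m.
Proof.
move=> [Scos Sact _] [s [<- sS <-]] {k m}.
elim/last_ind: s sS => [|s C IHs] sS.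
  by exists 1%g; [exact: word_ball_id|exact: act1].
rewrite -cats1 foldl_cat; have [|h hs <-] := IHs.
  by move=> D Ds; apply: sS; rewrite /= mem_rcons inE Ds orbT.
have SC : S C by apply: sS; rewrite /= mem_rcons mem_head.
have [c _ cE] := Scos _ SC.
rewrite /= -cE; have [t t0 ->] := semiact_act c h.
(* The stabiliser element [t] costs no extra letter: [t * c] lies in the translate of [C] by [t],
   which is again in [S]. *)
exists (h * (t * c))%g => //; rewrite size_cat; apply: word_ballM => //.
apply: word_ball1; exists (ltrans t C); first exact: Sact.
exists c => //; rewrite -cE; exists 1%g; rewrite ?mulg1//.
exact: stabiliser_id.
Qed.

Lemma cell_ball_word_ball S k :
  right_generating X S -> symmetric_cosets X S ->
  cell_ball X S k `<=` [set X g o | g in word_ball (\bigcup_(C in S) C) k].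
Proof.
move=> genS symS m; rewrite /cell_ball /cell_dist /=.
(* The default distance 0 would put unreachable points in every ball; generation by [S] rules them
   out. *)
case: pselect => [ex|[]]; last first.
  by have [n nm] := walk_origin m genS symS; exists n; exact/asboolP.
case: ex_minnP => n /asboolP nm _ nk.
have [g gn <-] := walk_word_ball genS nm.
by exists g => //; exact: word_ball_le gn.
Qed.

Lemma finite_bigcup_cosets S : finite_set G0 -> finite_set S ->
  S `<=` lcosets X -> finite_set (\bigcup_(C in S) C).
Proof.
move=> G0fin Sfin Scos; apply: bigcup_finite => // C /Scos[g _ <-].
exact: finite_image.
Qed.

(* If m = h o then m <| g G0 = h s g o for some s in G0; conversely, if
   m <| g G0 = h o then m = h t g^-1 o for some t in G0. As G0 is finite, the
   factors s g and t g^-1 have bounded length. *)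
Lemma semiact_displacement T C :
  finite_set G0 -> generating T -> set_inv T `<=` T -> lcosets X C ->
  exists K, forall n m,
    let F k := [set X g o | g in word_ball T k] in
    (F n m -> F (n + K)%N (semiact X m C)) /\
    (F n (semiact X m C) -> F (n + K)%N m).
Proof.
move=> G0fin genT symT [g _ <-].
have [K] : exists K, [set s * g | s in G0]%g `|` [set s * g^-1 | s in G0]%g
    `<=` word_ball T K.
  apply: finite_sub_word_ball => //.
  by rewrite finite_setU; split; exact: finite_image.
rewrite subUset => -[gK gVK]; exists K => n m; split=> -[h hn].
  move=> <-; have [s s0 ->] := semiact_act g h.
  by exists (h * (s * g))%g => //; apply: word_ballM => //; apply: gK; exists s.
rewrite -{1}(coordP X m); have [s s0 -> hE] := semiact_act g (Defs.coord X m).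
have t0 := act_eq_stabiliser hE.
(* The product collapses to [coord X m * s], and [s] fixes the origin. *)
exists (h * (h^-1 * (Defs.coord X m * (s * g)) * g^-1))%g.
  apply: word_ballM => //; apply: gVK.
  by exists (h^-1 * (Defs.coord X m * (s * g)))%g.
by rewrite !mulgA mulgV mul1g mulgK actM s0 coordP.
Qed.

End CellSpaces.

Theorem theorem11p3 (R : realType) (G : groupType) (M : choiceType)
    (X : cell_space G M) :
  finitely_right_generated X ->
  finite_set (stabiliser X) ->
  fin_generated G ->
  group_subexponential_growth R G ->
  cell_subexponential_growth R X /\ right_amenable R X.
Proof.
move=> _ G0fin [T0 T0fin genT0] subG; split.
  move=> cellE.
  (* The exponential lies in its own class, so the assumed equality provides an [S] whose
     [cell_gamma] dominates it. *)
  have : @exp_class R (fun k => expR k%:R).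
    split; last by split; exists 1%N => // k _; rewrite mul1r mul1n.
    by split=> [k l kl|k]; rewrite ?ler_expR ?ler_nat ?expR_ge0.
  rewrite -cellE => -[S [Sfin genS symS] [_ [cellS _]]].
  have [Scos _ _] := genS.
  have repfin := finite_bigcup_cosets G0fin Sfin Scos.
  (* The elements of the cosets in [S] become letters, so words in them keep their length over the
     enlarged generating set. *)
  have fsgT := fin_sym_generatingU genT0 T0fin repfin.
  apply: (subexponential_word_gamma subG fsgT).
  apply: le_dominates cellS => k; rewrite ler_nat.
  have [Tfin _ _] := fsgT; have Tkfin := finite_word_ball k Tfin.
  apply: leq_trans (leq_card_image (fun g => X g (origin X)) Tkfin).
  apply: leq_card_set; first exact: finite_image.
  apply: subset_trans (cell_ball_word_ball genS symS) _.
  apply: image_subset => g [s [sk sS <-]]; exists s; split=> //.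
  by move=> x /sS Sx; left; right.
(* Adjoining the empty set only symmetrises [T0]. *)
have fsgT := fin_sym_generatingU genT0 T0fin (finite_set0 G).
move: (_ `|` _) fsgT => T fsgT; have [Tfin genT symT] := fsgT.
pose F n := [set X g (origin X) | g in word_ball T n].
have Ffin n : finite_set (F n) by apply: finite_image; exact: finite_word_ball.
have F0 : F 0%N !=set0.
  by exists (X 1%g (origin X)), 1%g => //; exact: word_ball_id.
have Fle m n : (m <= n)%N -> F m `<=` F n.
  by move=> mn; apply: image_subset; exact: word_ball_le.
(* F(k) is an image of the word ball, so its exponential growth would pass to [word_gamma]. *)
have Fsub : ~ dominates (fun k => (card (F k))%:R) (fun k => expR k%:R : R).
  move=> Fexp; apply: (subexponential_word_gamma subG fsgT).
  apply: le_dominates Fexp => k; rewrite ler_nat leq_card_image//.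
  exact: finite_word_ball.
have Fratio := subexponential_ratio (card_set_gt0 (Ffin 0%N) F0) Fsub.
have [mu muP muE] := folner_mean R Ffin F0 Fle Fratio.
exists mu => // C A CX Cinj.
have [K KP] := semiact_displacement G0fin genT symT CX.
by apply: (muE _ _ K) => // n m; case: (KP n m).
Qed.
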